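(* Let $q\ge 3$ be a power of a prime $p$. The DGZ curve is absolutely irreducible; that is, the polynomial $F(x,y,z)$ defining it is irreducible over $\overline{\mathbb{F}}_q$.
   Context: Put $D_1(x,y,z)=\begin{vmatrix} x & x^q & x^{q^3}\\ y & y^q & y^{q^3}\\ z & z^q & z^{q^3}\end{vmatrix}$, $D_2(x,y,z)=\begin{vmatrix} x & x^q & x^{q^2}\\ y & y^q & y^{q^2}\\ z & z^q & z^{q^2}\end{vmatrix}$ and $F=D_1/D_2$, which is a homogeneous polynomial of degree $q^3-q^2$ over $\mathbb{F}_q$. The DGZ curve is the plane curve over $\overline{\mathbb{F}}_q$ with equation $F(x,y,z)=0$. *)

(* Defs.v *)
From HB Require Import structures.
From mathcomp Require Import all_boot all_order all_algebra all_fingroup all_solvable all_field.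
From mathcomp Require Import mpoly.
From mathcomp Require Import ring.
Set Implicit Arguments.
Unset Strict Implicit.
Unset Printing Implicit Defensive.
Import GRing.Theory.
Local Open Scope ring_scope.

Definition irreducible_elt (R : idomainType) (f : R) : Prop :=
  [/\ f != 0, f \isn't a GRing.unit &
      forall a b : R, f = a * b -> a \is a GRing.unit \/ b \is a GRing.unit].

Definition is_algebraic_closure (F : fieldType) (K : closedFieldType)
    (iota : {rmorphism F -> K}) : Prop :=
  forall z : K, algebraicOver iota z.

(* The rows of the matrix are indexed by the variables
   x = 'X_0, y = 'X_1, z = 'X_2, and the columns by the list of exponents s. *)
Definition moore_det (Fq : finFieldType) (s : seq nat) : {mpoly Fq[3]} :=
  \det (\matrix_(i < 3, j < 3) ('X_i : {mpoly Fq[3]}) ^+ (#|Fq| ^ nth 0%N s j)).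

Definition dgz_D1 (Fq : finFieldType) := moore_det Fq [:: 0; 1; 3]%N.
Definition dgz_D2 (Fq : finFieldType) := moore_det Fq [:: 0; 1; 2]%N.

Section Divisibility.
Variable Fq : finFieldType.
Local Notation q := #|Fq|.
Local Notation R := {mpoly Fq[3]}.
Local Notation M s := (moore_det Fq s).

Local Lemma det2_ord (S : comNzRingType) (A : nat -> nat -> S) :
  \det (\matrix_(i < 2, j < 2) A i j) = A 0%N 0%N * A 1%N 1%N - A 0%N 1%N * A 1%N 0%N.
Proof.
rewrite (expand_det_row _ ord0) !big_ord_recl big_ord0 /cofactor.
by rewrite !det_mx11 !mxE /=; ring.
Qed.

Local Lemma det3_ord (S : comNzRingType) (A : nat -> nat -> S) :
  \det (\matrix_(i < 3, j < 3) A i j) =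
    A 0%N 0%N * (A 1%N 1%N * A 2%N 2%N - A 1%N 2%N * A 2%N 1%N)
  - A 0%N 1%N * (A 1%N 0%N * A 2%N 2%N - A 1%N 2%N * A 2%N 0%N)
  + A 0%N 2%N * (A 1%N 0%N * A 2%N 1%N - A 1%N 1%N * A 2%N 0%N).
Proof.
rewrite (expand_det_row _ ord0) !big_ord_recl big_ord0 /cofactor.
have minor j : row' ord0 (col' j (\matrix_(i < 3, j < 3) A i j)) =
    \matrix_(i < 2, k < 2) A i.+1 (bump j k).
  by apply/matrixP => i k; rewrite !mxE.
rewrite !minor !(det2_ord (fun i k => A i.+1 (bump _ k))) !mxE /= /bump /=.
by ring.
Qed.

Let x : R := 'X_(inord 0).
Let y : R := 'X_(inord 1).
Let z : R := 'X_(inord 2).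

Local Lemma mooreE a b c :
  M [:: a; b; c] =
    x ^+ (q ^ a) * (y ^+ (q ^ b) * z ^+ (q ^ c) - y ^+ (q ^ c) * z ^+ (q ^ b))
  - x ^+ (q ^ b) * (y ^+ (q ^ a) * z ^+ (q ^ c) - y ^+ (q ^ c) * z ^+ (q ^ a))
  + x ^+ (q ^ c) * (y ^+ (q ^ a) * z ^+ (q ^ b) - y ^+ (q ^ b) * z ^+ (q ^ a)).
Proof.
pose A i j : R := 'X_(inord i) ^+ (q ^ nth 0%N [:: a; b; c] j).
transitivity (\det (\matrix_(i < 3, j < 3) A i j)).
  by congr (\det _); apply/matrixP => i j; rewrite !mxE /A inord_val.
by rewrite det3_ord.
Qed.

(* The 4 x 4 Moore determinant det(x, y, z, t), expanded along the
   row of t; it vanishes at every Fq-linear combination of x, y, z. *)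
Let B (t : R) : R :=
  M [:: 0; 1; 2]%N * t ^+ (q ^ 3) - M [:: 0; 1; 3]%N * t ^+ (q ^ 2)
  + M [:: 0; 2; 3]%N * t ^+ (q ^ 1) - M [:: 1; 2; 3]%N * t ^+ (q ^ 0).

Local Lemma frobD i (s t : R) : (s + t) ^+ (q ^ i) = s ^+ (q ^ i) + t ^+ (q ^ i).
Proof.
have [p p_pr pchF] := finPcharP Fq.
have pchR : p \in [pchar R].
  by rewrite inE p_pr -mpolyC_nat (pcharf0 pchF) mpolyC0 eqxx.
apply: exprDn_pchar; rewrite (eq_pnat _ (pcharf_eq pchR)).
rewrite pnatX; apply/orP; left.
have := pprimeChar_pgroup pchF; by rewrite /pgroup cardsT.
Qed.

Local Lemma frobZ i (a : Fq) (t : R) : (a *: t) ^+ (q ^ i) = a *: t ^+ (q ^ i).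
Proof.
rewrite exprZn; congr (_ *: _).
by elim: i => [|i IHi]; rewrite ?expr1 // expnSr exprM IHi expf_card.
Qed.

Local Lemma BD s t : B (s + t) = B s + B t.
Proof. by rewrite /B !frobD; ring. Qed.

Local Lemma BZ a t : B (a *: t) = a *: B t.
Proof. by rewrite /B !frobZ -!mul_mpolyC; ring. Qed.

Local Lemma Bx : B x = 0. Proof. by rewrite /B !mooreE; ring. Qed.
Local Lemma By : B y = 0. Proof. by rewrite /B !mooreE; ring. Qed.
Local Lemma Bz : B z = 0. Proof. by rewrite /B !mooreE; ring. Qed.

Let lin (u : Fq * Fq * Fq) : R := u.1.1 *: x + u.1.2 *: y + u.2 *: z.

Local Lemma B_lin u : B (lin u) = 0.
Proof. by rewrite !BD !BZ Bx By Bz !scaler0 !addr0. Qed.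

Local Lemma lin_inj : injective lin.
Proof.
move=> [[a b] c] [[a' b'] c'] /= eq_l.
have cf k : (lin (a, b, c))@_U_(inord k) = (lin (a', b', c'))@_U_(inord k).
  by rewrite eq_l.
have eqU i j : (i < 3)%N -> (j < 3)%N ->
    (U_((inord i : 'I_3)) == U_((inord j : 'I_3)))%MM = (i == j).
  move=> lti ltj.
  by rewrite eq_mnm1 -val_eqE /= !inordK.
move: (cf 0%N) (cf 1%N) (cf 2%N).
rewrite /lin !mcoeffD !mcoeffZ !mcoeffX !eqU //= ?mulr1 ?mulr0 ?addr0 ?add0r.
by move=> -> -> ->.
Qed.

Local Lemma prod_XsubC_factor (S : idomainType) (p : {poly S}) (rs : seq S) :
  uniq rs -> all (root p) rs ->
  exists r, p = r * \prod_(a <- rs) ('X - a%:P).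
Proof.
elim: rs p => [|a rs IHrs] p /=.
  by move=> _ _; exists p; rewrite big_nil mulr1.
case/andP=> a_rs urs /andP[/factor_theorem[r ->] rt].
have [|r' def_r] := IHrs r urs.
  apply/allP=> b rs_b; have := allP rt b rs_b.
  rewrite rootM root_XsubC => /orP[//|/eqP eq_ba].
  by rewrite -eq_ba rs_b in a_rs.
by exists r'; rewrite def_r big_cons; ring.
Qed.

Lemma dgz_D2_dvd_D1 : exists F : R, F * dgz_D2 Fq == dgz_D1 Fq.
Proof.
pose P : {poly R} := M [:: 0; 1; 2]%N *: 'X^(q ^ 3) - M [:: 0; 1; 3]%N *: 'X^(q ^ 2)
  + M [:: 0; 2; 3]%N *: 'X^(q ^ 1) - M [:: 1; 2; 3]%N *: 'X^(q ^ 0).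
have PE t : P.[t] = B t by rewrite /P /B !hornerE.
pose rs := [seq lin u | u <- enum {: Fq * Fq * Fq}].
have rs_uniq : uniq rs by rewrite (map_inj_uniq lin_inj) enum_uniq.
have rsP : all (root P) rs.
  by apply/allP=> _ /mapP[u _ ->]; rewrite /root PE B_lin.
have [S defP] := prod_XsubC_factor rs_uniq rsP.
set Q := \prod_(a <- rs) _ in defP.
have Qmon : Q \is monic by apply: monic_prod_XsubC.
have szQ : size Q = (q ^ 3).+1.
  rewrite size_prod_XsubC size_map -cardE !card_prod.
  by rewrite !expnS expn0 muln1 mulnA.
have q1 : (1 < q)%N by apply: finNzRing_gt1.
have neq i j : (q ^ i == q ^ j)%N = (i == j) by rewrite eqn_exp2l.
have cP i : P`_(q ^ i) = M [:: 0; 1; 2]%N *+ (i == 3) - M [:: 0; 1; 3]%N *+ (i == 2)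
    + M [:: 0; 2; 3]%N *+ (i == 1) - M [:: 1; 2; 3]%N *+ (i == 0).
  by rewrite /P !(coefD, coefN, coefZ, coefXn) !neq !mulr_natr.
have szP : (size P <= (q ^ 3).+1)%N.
  have le i : (i <= 3)%N -> (q ^ i < (q ^ 3).+1)%N.
    by move=> i3; rewrite ltnS leq_exp2l.
  have sz i (c : R) : (i <= 3)%N -> (size (c *: 'X^(q ^ i)) <= (q ^ 3).+1)%N.
    move=> i3; apply: leq_trans (size_scale_leq _ _) _.
    by rewrite size_polyXn le.
  by do 3! [apply: leq_trans (size_polyD _ _) _; rewrite geq_max ?size_polyN ?sz // andbT].
have szS : (size S <= 1)%N.
  have [->|S0] := eqVneq S 0; first by rewrite size_poly0.
  by move: szP; rewrite defP (size_Mmonic S0 Qmon) szQ addnS /= -[X in (_ <= X)%N]add1n leq_add2r.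
have defS := size1_polyC szS.
have lcQ : Q`_(q ^ 3) = 1 by move/monicP: Qmon; rewrite /lead_coef szQ.
have defS0 : S`_0 = dgz_D2 Fq.
  have := cP 3%N; rewrite defP defS coefCM lcQ !mulr1n !mulr0n.
  by rewrite mulr1 subr0 addr0 subr0 coefC /=.
exists (- Q`_(q ^ 2)); apply/eqP.
have := cP 2%N; rewrite defP defS coefCM defS0 !mulr1n !mulr0n.
rewrite sub0r addr0 subr0 => e.
by rewrite mulNr mulrC e opprK.
Qed.

Lemma dgz_D2_neq0 : dgz_D2 Fq != 0.
Proof.
pose e i j k : 'X_{1..3} := (U_(inord 0%N) *+ q ^ i + U_(inord 1%N) *+ q ^ j + U_(inord 2%N) *+ q ^ k)%MM.
have X_e i j k : x ^+ (q ^ i) * y ^+ (q ^ j) * z ^+ (q ^ k) = 'X_[e i j k].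
  by rewrite !mpolyXD !mpolyXn.
have e0 i j k : e i j k (inord 0%N) = (q ^ i)%N.
  by rewrite !(mnmDE, mulmnE, mnm1E) -!val_eqE /= !inordK //= mul1n !mul0n !addn0.
have e1 i j k : e i j k (inord 1%N) = (q ^ j)%N.
  by rewrite !(mnmDE, mulmnE, mnm1E) -!val_eqE /= !inordK //= mul1n !mul0n add0n addn0.
have q1 : (1 < q)%N by apply: finNzRing_gt1.
have ne i j k i' j' k' : (i, j) != (i', j') -> (e i j k == e i' j' k') = false.
  apply: contraNF => /eqP ee; rewrite xpair_eqE.
  have := congr1 (fun m : 'X_{1..3} => m (inord 0%N)) ee.
  have := congr1 (fun m : 'X_{1..3} => m (inord 1%N)) ee.
  rewrite !e0 !e1 => /eqP; rewrite eqn_exp2l // => ->.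
  by move=> /eqP; rewrite eqn_exp2l // => ->.
have -> : dgz_D2 Fq = 'X_[e 0%N 1%N 2%N] - 'X_[e 0%N 2%N 1%N] - 'X_[e 1%N 0%N 2%N]
    + 'X_[e 1%N 2%N 0%N] + 'X_[e 2%N 0%N 1%N] - 'X_[e 2%N 1%N 0%N].
  by rewrite /dgz_D2 mooreE -!X_e; ring.
apply/eqP=> /(congr1 (mcoeff (e 0 1 2)%N)).
rewrite !(mcoeffD, mcoeffB, mcoeffN, mcoeffX) eqxx !ne //= mcoeff0 !subr0 !addr0.
by move/eqP; rewrite oner_eq0.
Qed.

End Divisibility.

(* F = D1 / D2, the exact quotient; dgz_polyE characterizes it. *)
Definition dgz_poly (Fq : finFieldType) : {mpoly Fq[3]} :=
  xchoose (dgz_D2_dvd_D1 Fq).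

Lemma dgz_polyE (Fq : finFieldType) (F : {mpoly Fq[3]}) :
  F = dgz_poly Fq <-> F * dgz_D2 Fq = dgz_D1 Fq.
Proof.
have /eqP dgzP := xchooseP (dgz_D2_dvd_D1 Fq).
split=> [->//|]; rewrite -dgzP; exact/mulIf/dgz_D2_neq0.
Qed.

(* Main.v *)
Require Import Defs.
From HB Require Import structures.
From mathcomp Require Import all_boot all_order all_algebra all_fingroup all_solvable all_field.
From mathcomp Require Import mpoly.
From mathcomp Require Import ring zify.
Set Implicit Arguments.
Unset Strict Implicit.
Unset Printing Implicit Defensive.
Import GRing.Theory.
Local Open Scope ring_scope.

(* Write [d = x y^q - x^q y], [c = (x y^(q^2) - x^(q^2) y) / d] and
   [V = z^(q^2) - c z^q + d^(q-1) z]. Then [F = V^(q-1) + c^q], as for Dickson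
   invariants, and this expression is invariant under cyclic permutations of
   the variables. Suppose [F = G H]. If [G] or [H] does not vanish at the origin
   it is constant, [F] being homogeneous. Otherwise the curves [G = 0] and
   [H = 0] meet in the projective plane, at a singular point of [F = 0]. This
   point is not rational over Fq, so that [d <> 0] there after a cyclic
   permutation, and since [dF/dz = - V^(q-2) d^(q-1)] both [V] and [c] vanish at
   it (here [q >= 3] is used). But near such a point [F] is a unit times
   [z^(q-1)], plus a unit times [x^q], plus terms of higher weight, in suitable
   local coordinates [x], [z]; as q-1 and q are coprime, [F] is locally
   irreducible, and [G] and [H] cannot both vanish. *)

(** * The Dickson form and its homogeneity *)

Section DicksonForm.
Variables (A : comNzRingType) (q : nat).
Implicit Types x y z : A.

Definition bracket x y := x * y ^+ q - x ^+ q * y.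

(* The quotient of [x * y ^+ q ^+ q - x ^+ q ^+ q * y] by [bracket x y]. *)
Definition cofactor2 x y :=
  \sum_(i < q.+1) (x ^+ q.-1) ^+ (q - i) * (y ^+ q.-1) ^+ i.

(* In characteristic p this is the product of the [z + u] for [u] in the
   Fq-span of [x] and [y]. *)
Definition span_poly x y z :=
  z ^+ q ^+ q - cofactor2 x y * z ^+ q + bracket x y ^+ q.-1 * z.

Definition dickson x y z := span_poly x y z ^+ q.-1 + cofactor2 x y ^+ q.

(** The nine entries are free, so that both Moore determinants, D1 and D2, are instances. *)
Definition det3 (x x' x'' y y' y'' z z' z'' : A) :=
  x * (y' * z'' - y'' * z') - x' * (y * z'' - y'' * z) + x'' * (y * z' - y' * z).

Lemma det3_rot x x' x'' y y' y'' z z' z'' :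
  det3 x x' x'' y y' y'' z z' z'' = det3 y y' y'' z z' z'' x x' x''.
Proof. by rewrite /det3; ring. Qed.

(** A geometric sum in x^(q-1) and y^(q-1), multiplied by x y. *)
Lemma bracket_cofactor2 x y : (0 < q)%N ->
  cofactor2 x y * bracket x y = x * y ^+ q ^+ q - x ^+ q ^+ q * y.
Proof.
move=> q_gt0; have := subrXX (x ^+ q.-1) (y ^+ q.-1) q.+1; rewrite -/(cofactor2 x y).
have powE t : t * (t ^+ q.-1) ^+ q.+1 = t ^+ q ^+ q.
  by rewrite -!exprM -exprS; congr (_ ^+ _); nia.
have powE1 t : t ^+ q = t * t ^+ q.-1 by rewrite -exprS prednK.
rewrite /bracket -!powE; rewrite !powE1 => e.
have -> : x * (y * (y ^+ q.-1) ^+ q.+1) - x * (x ^+ q.-1) ^+ q.+1 * y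
  = - (x * y) * ((x ^+ q.-1) ^+ q.+1 - (y ^+ q.-1) ^+ q.+1) by ring.
by rewrite e; ring.
Qed.

Lemma cofactor2Z t x y : cofactor2 (t * x) (t * y) = t ^+ (q * q.-1) * cofactor2 x y.
Proof.
rewrite /cofactor2 mulr_sumr; apply: eq_bigr => i _.
rewrite !exprMn mulrACA; congr (_ * _).
by rewrite -!exprM -exprD -mulnDr subnK 1?mulnC // -ltnS.
Qed.

Lemma bracketZ t x y : bracket (t * x) (t * y) = t ^+ q.+1 * bracket x y.
Proof. by rewrite /bracket !exprMn exprS; ring. Qed.

Lemma span_polyZ t x y z : (0 < q)%N ->
  span_poly (t * x) (t * y) (t * z) = t ^+ (q * q) * span_poly x y z.
Proof.
move=> q_gt0; rewrite /span_poly cofactor2Z bracketZ !exprMn -!exprM.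
have -> : t ^+ (q.+1 * q.-1) * bracket x y ^+ q.-1 * (t * z) =
   t ^+ (q.+1 * q.-1).+1 * (bracket x y ^+ q.-1 * z) by rewrite exprS; ring.
have -> : t ^+ (q * q.-1) * cofactor2 x y * (t ^+ q * z ^+ q) =
   t ^+ (q * q.-1 + q) * (cofactor2 x y * z ^+ q) by rewrite exprD; ring.
have -> : (q.+1 * q.-1).+1 = (q * q)%N by nia.
have -> : (q * q.-1 + q)%N = (q * q)%N by nia.
by ring.
Qed.

Lemma dicksonZ t x y z : (0 < q)%N ->
  dickson (t * x) (t * y) (t * z) = t ^+ (q * q * q.-1) * dickson x y z.
Proof.
move=> q_gt0; rewrite /dickson span_polyZ // cofactor2Z !exprMn -!exprM.
by rewrite mulrDr; congr (t ^+ _ * _ + t ^+ _ * _); nia.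
Qed.

End DicksonForm.

(** * Compatibility with ring morphisms *)

Section DicksonMorphism.
Variables (A B : comNzRingType) (f : {rmorphism A -> B}) (q : nat).

Lemma rmorph_bracket x y : f (bracket q x y) = bracket q (f x) (f y).
Proof. by rewrite rmorphB !rmorphM !rmorphXn. Qed.

Lemma rmorph_cofactor2 x y : f (cofactor2 q x y) = cofactor2 q (f x) (f y).
Proof. by rewrite rmorph_sum; apply: eq_bigr => i _; rewrite rmorphM !rmorphXn. Qed.

Lemma rmorph_span_poly x y z : f (span_poly q x y z) = span_poly q (f x) (f y) (f z).
Proof.
by rewrite rmorphD rmorphB !rmorphM !rmorphXn rmorph_cofactor2 rmorph_bracket.
Qed.

Lemma rmorph_dickson x y z : f (dickson q x y z) = dickson q (f x) (f y) (f z).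
Proof. by rewrite rmorphD !rmorphXn rmorph_cofactor2 rmorph_span_poly. Qed.

End DicksonMorphism.

(** * Moore determinants under an additive q-power map *)

Section Frobenius.
Variables (A : idomainType) (q : nat).
Hypothesis q_gt0 : (0 < q)%N.
Hypothesis frobD : {morph (fun s : A => s ^+ q) : s t / s + t}.
Implicit Types x y z s t a b : A.

Lemma frobB s t : (s - t) ^+ q = s ^+ q - t ^+ q.
Proof. by apply/eqP; rewrite -subr_eq opprK -frobD subrK. Qed.

(** Expansion along the row of [z]: with d the bracket and c the cofactor, the minors are d, c d and
    d^q. *)
Lemma bracket_span_poly x y z :
  bracket q x y * span_poly q x y z =
  det3 x (x ^+ q) (x ^+ q ^+ q) y (y ^+ q) (y ^+ q ^+ q) z (z ^+ q) (z ^+ q ^+ q).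
Proof.
have e := bracket_cofactor2 x y q_gt0.
have -> : bracket q x y * span_poly q x y z = bracket q x y * z ^+ q ^+ q
   - (cofactor2 q x y * bracket q x y) * z ^+ q + bracket q x y ^+ q * z.
  have <- : bracket q x y * bracket q x y ^+ q.-1 = bracket q x y ^+ q.
    by rewrite -exprS prednK.
  by rewrite /span_poly; ring.
by rewrite e /bracket frobB !exprMn /det3; ring.
Qed.

(* Multiplied by [bracket x y ^+ q], the coefficient of [z ^+ q] becomes a
   Pluecker relation. *)
Lemma dickson_det3 x y z : bracket q x y != 0 ->
  dickson q x y z *
    det3 x (x ^+ q) (x ^+ q ^+ q) y (y ^+ q) (y ^+ q ^+ q) z (z ^+ q) (z ^+ q ^+ q) =
    det3 x (x ^+ q) (x ^+ q ^+ q ^+ q) y (y ^+ q) (y ^+ q ^+ q ^+ q)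
      z (z ^+ q) (z ^+ q ^+ q ^+ q).
Proof.
move=> nz_d; rewrite -bracket_span_poly.
set d := bracket q x y in nz_d *; set c := cofactor2 q x y.
set v := span_poly q x y z.
have dE : d = x * y ^+ q - x ^+ q * y by [].
have cd : c * d = x * y ^+ q ^+ q - x ^+ q ^+ q * y by exact: bracket_cofactor2.
have dq : d ^+ q = x ^+ q * y ^+ q ^+ q - x ^+ q ^+ q * y ^+ q.
  by rewrite dE frobB !exprMn.
have cdq : c ^+ q * d ^+ q = x ^+ q * y ^+ q ^+ q ^+ q - x ^+ q ^+ q ^+ q * y ^+ q.
  by rewrite -exprMn cd frobB !exprMn.
have dqq : d ^+ q ^+ q = x ^+ q ^+ q * y ^+ q ^+ q ^+ q - x ^+ q ^+ q ^+ q * y ^+ q ^+ q.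
  by rewrite dq frobB !exprMn.
have vE : v = z ^+ q ^+ q - c * z ^+ q + d ^+ q.-1 * z by [].
have vq : v ^+ q = z ^+ q ^+ q ^+ q - c ^+ q * z ^+ q ^+ q + (d ^+ q) ^+ q.-1 * z ^+ q.
  by rewrite vE frobD frobB !exprMn -!exprM (mulnC q.-1).
have dvd : dickson q x y z * (d * v) = d * v ^+ q + c ^+ q * d * v.
  have <- : v * v ^+ q.-1 = v ^+ q by rewrite -exprS prednK.
  by rewrite /dickson -/v -/c; ring.
apply: (mulfI (expf_neq0 q nz_d)); rewrite dvd vq.
have dS : d * d ^+ q.-1 = d ^+ q by rewrite -exprS prednK.
have dqS : d ^+ q * (d ^+ q) ^+ q.-1 = d ^+ q ^+ q by rewrite -exprS prednK.
have -> : d ^+ q * (d * (z ^+ q ^+ q ^+ q - c ^+ q * z ^+ q ^+ q + (d ^+ q) ^+ q.-1 * z ^+ q)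
    + c ^+ q * d * v) =
  d ^+ q * d * z ^+ q ^+ q ^+ q + d * (d ^+ q * (d ^+ q) ^+ q.-1) * z ^+ q
  - (c ^+ q * d ^+ q) * (c * d) * z ^+ q + (c ^+ q * d ^+ q) * (d * d ^+ q.-1) * z.
  by rewrite vE; ring.
by rewrite dS dqS cdq cd dqq dq dE /det3; ring.
Qed.

(** Multiplied by the nonzero Moore determinant, both sides become a determinant that is invariant
    under rotation. *)
Lemma dickson_rot x y z :
  det3 x (x ^+ q) (x ^+ q ^+ q) y (y ^+ q) (y ^+ q ^+ q) z (z ^+ q) (z ^+ q ^+ q) != 0 ->
  dickson q x y z = dickson q y z x.
Proof.
move=> nz_m; have nz_xy : bracket q x y != 0.
  by apply: contraNneq nz_m => d0; rewrite -bracket_span_poly d0 mul0r.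
have nz_yz : bracket q y z != 0.
  by apply: contraNneq nz_m => d0; rewrite det3_rot -bracket_span_poly d0 mul0r.
apply: (mulIf nz_m); rewrite dickson_det3 // det3_rot [in RHS]det3_rot.
by rewrite dickson_det3.
Qed.

(** All three cyclic orders are kept because the local study needs a nonzero bracket of the first
    two coordinates. *)
Lemma dickson_unique x y z f :
  let m x y z :=
    det3 x (x ^+ q) (x ^+ q ^+ q) y (y ^+ q) (y ^+ q ^+ q) z (z ^+ q) (z ^+ q ^+ q) in
  m x y z != 0 ->
  f * m x y z = det3 x (x ^+ q) (x ^+ q ^+ q ^+ q) y (y ^+ q) (y ^+ q ^+ q ^+ q)
    z (z ^+ q) (z ^+ q ^+ q ^+ q) ->
  [/\ f = dickson q x y z, f = dickson q y z x & f = dickson q z x y].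
Proof.
move=> m nz_m fm.
have nz_d : bracket q x y != 0.
  by apply: contraNneq nz_m => d0; rewrite /m -bracket_span_poly d0 mul0r.
have e : f = dickson q x y z by apply: (mulIf nz_m); rewrite fm dickson_det3.
have e1 : f = dickson q y z x by rewrite -dickson_rot.
by split=> //; rewrite -dickson_rot // -det3_rot.
Qed.

Lemma span_polyD x y s t :
  span_poly q x y (s + t) = span_poly q x y s + span_poly q x y t.
Proof. by rewrite /span_poly !frobD /=; ring. Qed.

(** The third row of the Moore determinant depends linearly on the other two. *)
Lemma span_poly_lin x y a b : bracket q x y != 0 -> a ^+ q = a -> b ^+ q = b ->
  span_poly q x y (a * x + b * y) = 0.
Proof.
move=> nz_d aq bq; apply: (mulfI nz_d).
by rewrite bracket_span_poly !(frobD, exprMn, aq, bq) mulr0 /det3; ring.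
Qed.

End Frobenius.

(** * Substitution in multivariate polynomials *)

Section Evaluation.
Variables (K : fieldType) (n : nat).

Lemma rmorph_mmap (A B : comNzRingType) (g : {rmorphism A -> B}) (f : K -> A)
    (f' : K -> B) (v : 'I_n -> A) (v' : 'I_n -> B) (P : {mpoly K[n]}) :
  g \o f =1 f' -> g \o v =1 v' -> g (mmap f v P) = mmap f' v' P.
Proof.
move=> eq_f eq_v; rewrite rmorph_sum /=; apply: eq_bigr => m _.
rewrite rmorphM -[g (f _)]/((g \o f) _) eq_f; congr (_ * _).
by rewrite rmorph_prod; apply: eq_bigr => i _; rewrite rmorphXn /= -eq_v.
Qed.

End Evaluation.

(** * Orders of vanishing at zero *)

Section OrderAtZero.
Variable A : idomainType.
Implicit Types a b e r : {poly A}.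

(** 'X is prime over a domain: each factor 'X on the right divides [a] or [b] and can be
    cancelled. *)
Lemma mul_Xn_factor n a b e : a * b = 'X^n * e ->
  exists k l a1 b1, [/\ (k + l = n)%N, a = 'X^k * a1, b = 'X^l * b1 & e = a1 * b1].
Proof.
elim: n a b e => [|n IHn] a b e ab.
  by exists 0%N, 0%N, a, b; rewrite !expr0 !mul1r in ab *; split.
have: root a 0 || root b 0 by rewrite -rootM ab exprS -mulrA rootM rootX eqxx.
have X_neq0 : 'X != 0 :> {poly A} by rewrite polyX_eq0.
case/orP=> /factor_theorem[c]; rewrite polyC0 subr0 => def_c.
  have [|k [l [c1 [b1 [<- def_c1 -> ->]]]]] := IHn c b e.
    by apply: (mulfI X_neq0); rewrite [RHS]mulrA -exprS -ab def_c; ring.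
  by exists k.+1, l, c1, b1; split; rewrite // def_c def_c1 exprS; ring.
have [|k [l [a1 [c1 [<- -> def_c1 ->]]]]] := IHn a c e.
  by apply: (mulfI X_neq0); rewrite [RHS]mulrA -exprS -ab def_c; ring.
by exists k, l.+1, a1, c1; split; rewrite ?addnS // def_c def_c1 exprS; ring.
Qed.

(** The coefficients of p(X^m) vanish outside the multiples of m, while the one of degree k is
    r(0). *)
Lemma dvdn_order_comp_Xn (p r : {poly A}) m k : (0 < m)%N ->
  p \Po 'X^m = 'X^k * r -> r.[0] != 0 -> (m %| k)%N.
Proof.
move=> m_gt0 /(congr1 (fun p : {poly A} => p`_k)).
rewrite coef_comp_poly_Xn // coefXnM ltnn subnn horner_coef0.
by case: ifP => // _ <-; rewrite eqxx.
Qed.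

End OrderAtZero.

Definition coords (A : Type) (i j : 'I_3) (x y z : A) (m : 'I_3) : A :=
  if m == i then x else if m == j then y else z.

(** * Local study at a common zero of two factors *)

Section LocalFactorization.
Variables (K : fieldType) (p h q : nat).
Hypothesis pcharK : p \in [pchar K].
Hypothesis q_pX : q = (p ^ h)%N.
Hypothesis q_ge3 : (3 <= q)%N.

Lemma frob_pchar (A : comNzRingType) (f : {rmorphism K -> A}) :
  {morph (fun s : A => s ^+ q) : s t / s + t}.
Proof.
move=> s t /=; have pcharA := rmorph_pchar f pcharK.
apply: exprDn_pchar; rewrite (eq_pnat _ (pcharf_eq pcharA)) q_pX pnatX pnat_id //.
exact: pcharf_prime pcharA.
Qed.

Lemma natr_q : q%:R = 0 :> K.
Proof.
apply/eqP; rewrite -(dvdn_pcharf pcharK) q_pX dvdn_exp // lt0n.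
by apply: contraTneq q_ge3 => h0; rewrite q_pX h0.
Qed.

Variables (i j k : 'I_3) (G H : {mpoly K[3]}).
Hypothesis ijk : uniq [:: i; j; k].
Hypothesis GH : G * H = dickson q 'X_i 'X_j 'X_k.

Lemma mmap_coordsM (A : comNzRingType) (f : {rmorphism K -> A}) (x y z : A) :
  mmap f (coords i j x y z) G * mmap f (coords i j x y z) H = dickson q x y z.
Proof.
move: ijk; rewrite /= !inE !andbT negb_or => /andP[/andP[ij ik] jk].
rewrite -rmorphM GH rmorph_dickson /= !mmapX !mmap1U /coords eqxx.
by rewrite (eq_sym j i) (eq_sym k i) (eq_sym k j) (negPf ij) (negPf ik) (negPf jk) eqxx.
Qed.

Variables x0 y0 z0 : K.
Hypothesis nz_d : bracket q x0 y0 != 0.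
Hypothesis G0 : mmap idfun (coords i j x0 y0 z0) G = 0.
Hypothesis H0 : mmap idfun (coords i j x0 y0 z0) H = 0.

Let q_gt0 : (0 < q)%N. Proof. exact: leq_trans q_ge3. Qed.

(** A product of two functions vanishing at the point has zero derivative there. In the direction of
    z, q-th powers have derivative 0, so that of F is (q-1) V^(q-2) d^(q-1), where d and q-1 are
    nonzero in [K]. *)
Lemma common_zero_span : span_poly q x0 y0 z0 = 0.
Proof.
pose x := x0%:P; pose y := y0%:P; pose z := z0%:P + 'X.
pose g := mmap (@polyC K) (coords i j x y z) G.
pose h' := mmap (@polyC K) (coords i j x y z) H.
have gh : g * h' = dickson q x y z by apply: (mmap_coordsM (@polyC K)).
have ev0 P : (mmap (@polyC K) (coords i j x y z) P).[0]
    = mmap idfun (coords i j x0 y0 z0) P.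
  rewrite -horner_evalE; apply: rmorph_mmap => [t|m] /=; rewrite horner_evalE.
    by rewrite hornerC.
  by rewrite /coords; case: ifP => _; last case: ifP => _; rewrite !hornerE.
have gh'0 : (g * h')^`().[0] = 0 by rewrite derivM !hornerE /= !ev0 G0 H0; ring.
have frobP := frob_pchar (@polyC K).
have mulrn_q (u : {poly K}) : u *+ q = 0 by rewrite -mulr_natr -polyC_natr natr_q mulr0.
have v'0 : (span_poly q x y z)^`().[0] = bracket q x0 y0 ^+ q.-1.
  rewrite /span_poly -rmorph_cofactor2 -rmorph_bracket -rmorphXn /=.
  rewrite derivD derivB !deriv_mulC !deriv_exp derivD derivC derivX add0r.
  by rewrite !mulrn_q mulr0 subr0 add0r mulr1 hornerC.
have v0 : (span_poly q x y z).[0] = span_poly q x0 y0 z0.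
  by rewrite -horner_evalE rmorph_span_poly /= !horner_evalE !hornerE.
move: gh'0; rewrite gh /dickson derivD !deriv_exp mulrn_q addr0.
rewrite hornerMn hornerM horner_exp v'0 v0.
rewrite -mulr_natr => /eqP; rewrite !mulf_eq0 !expf_eq0 (negPf nz_d) andbF /=.
case/orP=> [/andP[_ /eqP //]|/eqP q1].
by have := natr_q; rewrite -(prednK q_gt0) -natr1 q1 add0r => /eqP; rewrite oner_eq0.
Qed.

Lemma common_zero_cofactor2 : cofactor2 q x0 y0 = 0.
Proof.
have := mmap_coordsM idfun x0 y0 z0; rewrite G0 mul0r /dickson common_zero_span.
rewrite expr0n; case: eqP => [|_ /esym/eqP]; first by lia.
by rewrite add0r expf_eq0 q_gt0 => /eqP.
Qed.

(* Cramer's rule for the coefficients; they lie in Fq because the q^2-power map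
   multiplies each of [x0], [y0], [z0] by [- bracket q x0 y0 ^+ q.-1]. *)
Lemma common_zero_lin :
  exists a b, [/\ a ^+ q = a, b ^+ q = b & z0 = a * x0 + b * y0].
Proof.
have frobK := frob_pchar (@idfun K).
have := common_zero_span; rewrite /span_poly common_zero_cofactor2 mul0r subr0.
have := bracket_cofactor2 x0 y0 q_gt0; rewrite common_zero_cofactor2 mul0r => /esym/eqP.
rewrite subr_eq0 => /eqP xy /eqP; rewrite addr_eq0 => /eqP z2.
have := nz_d; set d := bracket q x0 y0 in z2 * => nz.
have dE : d = x0 * y0 ^+ q - x0 ^+ q * y0 by [].
have dq : d * d ^+ q.-1 = x0 ^+ q * y0 ^+ q ^+ q - x0 ^+ q ^+ q * y0 ^+ q.
  by rewrite -exprS prednK // dE frobB // !exprMn.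
have x2 : x0 ^+ q ^+ q = - (d ^+ q.-1 * x0).
  apply: (mulfI nz); rewrite mulrN mulrA dq dE.
  transitivity (x0 ^+ q ^+ q * y0 ^+ q * x0 - x0 ^+ q * (x0 * y0 ^+ q ^+ q)).
    by rewrite xy; ring.
  by ring.
have y2 : y0 ^+ q ^+ q = - (d ^+ q.-1 * y0).
  apply: (mulfI nz); rewrite mulrN mulrA dq dE.
  transitivity (y0 ^+ q * (x0 ^+ q ^+ q * y0) - x0 ^+ q * y0 ^+ q ^+ q * y0).
    by rewrite -xy; ring.
  by ring.
have dqE : d ^+ q = d * d ^+ q.-1 by rewrite -exprS prednK.
have nz_dq : d ^+ q.-1 != 0 by rewrite expf_neq0.
exists ((z0 * y0 ^+ q - z0 ^+ q * y0) / d), ((x0 * z0 ^+ q - x0 ^+ q * z0) / d).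
split; last by rewrite dE; field; rewrite -dE.
  by rewrite !(exprMn, exprVn) frobB // !exprMn y2 z2 dqE; field; rewrite nz nz_dq.
by rewrite !(exprMn, exprVn) frobB // !exprMn x2 z2 dqE; field; rewrite nz nz_dq.
Qed.

(* Along [x = x0 + (1 - v) T^(q-1)], [y = y0], [z = a x + b y + v T^q] the form
   vanishes to order q(q-1) in [T], for [v = 0] and for [v = 1]. Hence [G] and [H]
   vanish to orders of sum q(q-1) which do not depend on [v]; these orders are
   multiples of q-1 and of q, so that one of them is zero. *)
Lemma no_common_zero : False.
Proof.
have [a [b [aq bq def_z0]]] := common_zero_lin.
(* The outer variable is [T], the inner one [v]; below, [ev0] sets T = 0 and [spec t] sets v = t. *)
pose io : {rmorphism K -> {poly {poly K}}} := @polyC {poly K} \o @polyC K.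
have frobP := frob_pchar io.
pose v : {poly {poly K}} := 'X%:P; pose T : {poly {poly K}} := 'X.
pose s := T ^+ q.-1 * (1 - v).
pose x := io x0 + s; pose y := io y0.
pose z := (io a * x + io b * y) + T ^+ q * v.
pose g := mmap io (coords i j x y z) G; pose h' := mmap io (coords i j x y z) H.
have gh : g * h' = dickson q x y z by apply: mmap_coordsM.
have [ev0 ev0E] : exists ev0 : {rmorphism {poly {poly K}} -> {poly K}},
    forall r, ev0 r = r.[0] by exists (horner_eval 0).
have ev0T n : (0 < n)%N -> ev0 (T ^+ n) = 0.
  by move=> n_gt0; rewrite rmorphXn ev0E hornerX expr0n gtn_eqF.
have ev0io t : ev0 (io t) = t%:P by rewrite ev0E hornerC.
have ev0v : ev0 v = 'X by rewrite ev0E hornerC.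
have q1_gt0 : (0 < q.-1)%N by lia.
have ev0s : ev0 s = 0 by rewrite rmorphM ev0T // mul0r.
have ev0x : ev0 x = x0%:P by rewrite rmorphD ev0io ev0s addr0.
have ev0y : ev0 y = y0%:P by rewrite ev0io.
have ev0d : ev0 (bracket q x y) = (bracket q x0 y0)%:P.
  by rewrite rmorph_bracket ev0x ev0y -(rmorph_bracket (@polyC K)).
have nz_dxy : bracket q x y != 0.
  apply: contraNneq nz_d => d0; rewrite -polyC_eq0 -ev0d d0 rmorph0.
  exact: eqxx.
(* By additivity only T^q v contributes, since [span_poly] kills a x + b y. *)
have [V1 def_V ev0V1] : exists2 V1 : {poly {poly K}}, span_poly q x y z = 'X^q * V1
    & ev0 V1 = (bracket q x0 y0)%:P ^+ q.-1 * 'X.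
  exists ((T ^+ q) ^+ (q * q).-1 * v ^+ q ^+ q
    - cofactor2 q x y * ((T ^+ q) ^+ q.-1 * v ^+ q) + bracket q x y ^+ q.-1 * v).
    rewrite span_polyD // span_poly_lin // -?(rmorphXn io) ?aq ?bq // add0r.
    rewrite /span_poly !exprMn -/T.
    have Tpow n : (0 < n)%N -> (T ^+ q) ^+ n = T ^+ q * (T ^+ q) ^+ n.-1.
      by move=> n_gt0; rewrite -exprS prednK.
    rewrite -[T ^+ q ^+ q ^+ q]exprM (Tpow (q * q)%N) ?muln_gt0 ?q_gt0 // (Tpow q) //.
    by ring.
  have ev0Tq n : (0 < n)%N -> ev0 ((T ^+ q) ^+ n) = 0.
    by move=> n_gt0; rewrite -exprM ev0T // muln_gt0 q_gt0.
  rewrite rmorphD rmorphB !rmorphM !ev0Tq //; last by nia.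
  by rewrite !mul0r mulr0 subr0 add0r ev0v rmorphXn ev0d.
have [c1 def_c ev0c1] : exists2 c1 : {poly {poly K}}, cofactor2 q x y = 'X^(q.-1) * c1
    & ev0 c1 * (bracket q x0 y0)%:P = (1 - 'X) * (y0 ^+ q ^+ q)%:P.
  have := bracket_cofactor2 x y q_gt0; set e := (X in _ = X).
  (* The part free of [s] vanishes with the cofactor at (x0, y0). There remains s y^(q^2) - s^(q^2)
     y, and [s] is a multiple of T^(q-1). *)
  have -> : e = 'X^(q.-1) * ((1 - v) * (y ^+ q ^+ q - s ^+ (q * q).-1 * y)).
    rewrite /e !frobP /= mulrDl -!(rmorphXn io) -!(rmorphM io).
    have := bracket_cofactor2 x0 y0 q_gt0; rewrite common_zero_cofactor2 mul0r.
    move/esym/eqP; rewrite subr_eq0 => /eqP ->.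
    have -> : s ^+ q ^+ q = s * s ^+ (q * q).-1.
      by rewrite -exprM -exprS prednK // muln_gt0 q_gt0.
    by rewrite rmorphM -/y; set u := s ^+ (q * q).-1; rewrite /s -/T; ring.
  case/mul_Xn_factor=> k1 [l1 [c1 [d1 [kl def_c def_d ecd]]]].
  (* The bracket is nonzero at T = 0, so the whole power T^(q-1) divides the cofactor. *)
  have l0 : l1 = 0%N.
    apply/eqP; rewrite eqn0Ngt; apply: contra nz_d => l_gt0.
    by rewrite -polyC_eq0 -ev0d def_d rmorphM ev0T // mul0r.
  rewrite l0 addn0 in kl; rewrite l0 expr0 mul1r in def_d; rewrite kl in def_c.
  exists c1 => //; rewrite -ev0d def_d -rmorphM -ecd rmorphM rmorphB rmorph1 ev0v.
  rewrite rmorphB rmorphM !rmorphXn ev0s ev0y expr0n.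
  have -> : ((q * q).-1 == 0)%N = false by apply/negbTE; nia.
  by rewrite mul0r subr0.
have nz_y : y0 != 0.
  by apply: contraNneq nz_d => ->; rewrite /bracket expr0n gtn_eqF // !mulr0 subrr.
(* Both V^(q-1) and c^q carry the factor T^(q(q-1)); [k1] and [l1] are the shares of [g] and
   [h']. *)
move: gh; rewrite /dickson def_V def_c !exprMn -!exprM (mulnC q.-1) -mulrDr.
set E := _ + _; case/mul_Xn_factor=> k1 [l1 [g1 [h1 [kl def_g def_h def_E]]]].
have ev0_E : ev0 E = ev0 V1 ^+ q.-1 + ev0 c1 ^+ q by rewrite rmorphD !rmorphXn.
(* At T = 0 exactly one term of [E] survives: c1^q for v = 0, as y0 is nonzero, and V1^(q-1) for v =
   1. *)
have nz_E t : (t == 0) || (t == 1) -> (ev0 E).[t] != 0.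
  move=> t01; have := congr1 (horner_eval t) ev0c1.
  rewrite !horner_evalE !hornerE => ec.
  rewrite ev0_E ev0V1 !hornerE; case/orP: t01 ec => /eqP-> ec.
    rewrite mulr0 expr0n gtn_eqF // add0r expf_neq0 //.
    apply: contraNneq nz_y => c10; move/eqP: ec; rewrite c10 mul0r eq_sym subr0 mul1r.
    by rewrite !expf_eq0 q_gt0.
  move/eqP: ec; rewrite subrr mul0r mulf_eq0 (negPf nz_d) orbF => /eqP->.
  by rewrite expr0n gtn_eqF // addr0 mulr1 !expf_neq0.
have nz_gh t : (t == 0) || (t == 1) -> ((ev0 g1).[t] != 0) /\ ((ev0 h1).[t] != 0).
  by move/nz_E; rewrite def_E rmorphM hornerM mulf_eq0 negb_or => /andP.
have [spec specE] : exists spec : K -> {rmorphism {poly {poly K}} -> {poly K}},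
    forall t u, spec t u = map_poly (horner_eval t) u.
  by exists (fun t => map_poly (horner_eval t)).
have specio t u : spec t (io u) = u%:P by rewrite specE map_polyC /= horner_evalE hornerC.
have specT t n : spec t (T ^+ n) = 'X^n by rewrite rmorphXn specE map_polyX.
have specv t : spec t v = t%:P by rewrite specE map_polyC /= horner_evalE hornerX.
have spec0 t u : (spec t u).[0] = (ev0 u).[t].
  by rewrite specE ev0E [LHS]horner_coef0 coef_map /= horner_evalE (horner_coef0 u).
have specx t : spec t x = x0%:P + 'X^(q.-1) * (1 - t%:P).
  by rewrite rmorphD rmorphM rmorphB rmorph1 specio specT specv.
have specz t : spec t z = a%:P * spec t x + b%:P * y0%:P + 'X^q * t%:P.
  by rewrite [LHS]rmorphD [X in X + _]rmorphD !rmorphM !specio specT specv.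
(* If the curve v = u depends on T only through T^m, then m divides the order [k1] of [G] along
   it. *)
have dvd_k1 m u X Z : (0 < m)%N -> (u == 0) || (u == 1) ->
    X \Po 'X^m = spec u x -> Z \Po 'X^m = spec u z -> (m %| k1)%N.
  move=> m_gt0 t01 eX eZ.
  apply: (@dvdn_order_comp_Xn _ (mmap (@polyC K) (coords i j X y0%:P Z) G) (spec u g1)) => //.
    rewrite -[X in _ = X * _](specT u) -rmorphM -def_g.
    transitivity (mmap (@polyC K) (coords i j (spec u x) (spec u y) (spec u z)) G).
      apply: (rmorph_mmap (g := comp_poly 'X^m)) => [r|n] /=; first exact: comp_polyC.
      rewrite -eX -eZ specio /coords; case: ifP => // _; case: ifP => // _.
      exact: comp_polyC.
    apply/esym/rmorph_mmap => [r|n] /=; first exact: specio.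
    by rewrite /coords; case: ifP => // _; case: ifP.
  by rewrite spec0; case: (nz_gh u t01).
(* For v = 0 all coordinates are polynomials in T^(q-1). *)
have dvd_q1 : (q.-1 %| k1)%N.
  apply: (dvd_k1 _ 0 (x0%:P + 'X) (a%:P * (x0%:P + 'X) + b%:P * y0%:P)); rewrite ?eqxx //.
    by rewrite specx comp_polyD comp_polyC comp_polyX subr0 mulr1.
  rewrite specz specx !(comp_polyD, comp_polyM, comp_polyC, comp_polyX).
  by rewrite subr0 !mulr1 mulr0 addr0.
(* For v = 1 only z moves, by T^q. *)
have dvd_q : (q %| k1)%N.
  apply: (dvd_k1 _ 1 x0%:P (a%:P * x0%:P + b%:P * y0%:P + 'X)); rewrite ?eqxx ?orbT //.
    by rewrite specx comp_polyC subrr mulr0 addr0.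
  rewrite specz specx !(comp_polyD, comp_polyM, comp_polyC, comp_polyX).
  by rewrite subrr mulr0 addr0 mulr1.
have : (q * q.-1 %| k1)%N.
  by rewrite Gauss_dvd ?dvd_q ?dvd_q1 // coprime_sym -{2}(prednK q_gt0) coprimenS.
have ev00 P : (ev0 (mmap io (coords i j x y z) P)).[0] =
    mmap idfun (coords i j x0 y0 z0) P.
  rewrite -horner_evalE -[LHS]/((horner_eval 0 \o ev0) _).
  apply: rmorph_mmap => [u|n] /=.
    by rewrite -/(io u) ev0io horner_evalE hornerC.
  rewrite /coords; case: ifP => _; first by rewrite ev0x horner_evalE hornerC.
  case: ifP => _; first by rewrite ev0y horner_evalE hornerC.
  rewrite rmorphD rmorphM ev0T // mul0r addr0 rmorphD !rmorphM !ev0io ev0x.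
  by rewrite horner_evalE !hornerE def_z0.
have [nz_g1 nz_h1] : ((ev0 g1).[0] != 0) /\ ((ev0 h1).[0] != 0).
  by apply: nz_gh; rewrite eqxx.
(* Since k1 + l1 = q(q-1), one order is 0, and the corresponding factor would be nonzero at the
   point. *)
move=> dvd_qq; have [k0|l0] : k1 = 0%N \/ l1 = 0%N.
  case/dvdnP: dvd_qq => -[|n]; first by rewrite mul0n; left.
  by rewrite mulSn => k1E; right; lia.
- by move: nz_g1 (ev00 G); rewrite G0 -/g def_g k0 expr0 mul1r => /eqP.
by move: nz_h1 (ev00 H); rewrite H0 -/h' def_h l0 expr0 mul1r => /eqP.
Qed.

End LocalFactorization.

(** * Values at rational points, and the leading coefficient in z *)

Lemma dickson_rational (K : fieldType) q (x y z : K) : (1 < q)%N -> q%:R = 0 :> K ->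
  x != 0 -> bracket q x y = 0 -> bracket q x z = 0 -> dickson q x y z != 0.
Proof.
move=> q_gt1 q0 nz_x xy xz; have q_gt0 := ltnW q_gt1.
have q1_neq0 : (q.-1 == 0)%N = false by rewrite gtn_eqF // -ltnS prednK.
have ratio_fix t : bracket q x t = 0 -> (t / x) ^+ q = t / x.
  move=> /eqP; rewrite subr_eq0 => /eqP xt; rewrite exprMn exprVn.
  by apply/eqP; rewrite eqr_div ?expf_neq0 // mulrC xt mulrC.
(* Scaling reduces to a point (1, b, c) with b and c fixed by the q-power map; there [cofactor2] is
   1 and [span_poly] is 0. *)
rewrite -[y](divfK nz_x) -[z](divfK nz_x) ![_ / x * x]mulrC -[x in dickson q x]mulr1.
rewrite dicksonZ // mulf_neq0 ?expf_neq0 //.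
have bq := ratio_fix y xy; have cq := ratio_fix z xz.
move: (y / x) (z / x) bq cq => b c bq cq.
have cof1 : cofactor2 q 1 b = 1.
  rewrite /cofactor2 (eq_bigr (fun i : 'I_q.+1 => (b ^+ q.-1) ^+ i)); last first.
    by move=> i _; rewrite !expr1n mul1r.
  (* For b = 0 only the term 0^0 = 1 survives; otherwise there are q+1 terms equal to 1, and q = 0
     in [K]. *)
  have [b0|nz_b] := eqVneq b 0.
    rewrite big_ord_recl big1 ?addr0 ?expr0 // => i _.
    by rewrite b0 -exprM expr0n muln_eq0 q1_neq0.
  have -> : b ^+ q.-1 = 1 by apply: (mulfI nz_b); rewrite -exprS prednK // mulr1.
  rewrite (eq_bigr (fun=> 1)) => [|i _]; last by rewrite expr1n.
  by rewrite sumr_const card_ord -natr1 q0 add0r.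
rewrite /dickson /span_poly cof1 /bracket expr1n bq !mul1r subrr !cq subrr add0r.
by rewrite !(expr0n, q1_neq0, mul0r, add0r) oner_neq0.
Qed.

(** The power z^(q^2) dominates [span_poly], and c^q is constant in z. Hence factors of the form
    have unit leading coefficients. *)
Lemma lead_coef_dickson (A : idomainType) q (x y : A) : (1 < q)%N ->
  lead_coef (dickson q x%:P y%:P 'X) = 1.
Proof.
move=> q_gt1; have q_gt0 := ltnW q_gt1.
rewrite /dickson /span_poly -rmorph_cofactor2 -rmorph_bracket -!rmorphXn /=.
set c := cofactor2 q x y; set d := bracket q x y ^+ q.-1.
have szr : (size (- (c%:P * 'X^q) + d%:P * 'X)%R < size ('X^(q * q) : {poly A}))%N.
  rewrite size_polyXn ltnS !mul_polyC; apply: leq_trans (size_polyD _ _) _.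
  rewrite size_polyN geq_max; apply/andP; split.
    by apply: leq_trans (size_scale_leq _ _) _; rewrite size_polyXn; nia.
  by apply: leq_trans (size_scale_leq _ _) _; rewrite size_polyX; nia.
rewrite -exprM -addrA; set v := 'X^(q * q) + _.
have v_monic : v \is monic by rewrite monicE lead_coefDl // lead_coefXn.
have szv : size v = (q * q).+1 by rewrite size_polyDl // size_polyXn.
rewrite lead_coefDl; first by apply/monicP; rewrite monic_exp.
apply: leq_ltn_trans (size_polyC_leq1 _) _.
have /(_ q.-1) := size_exp v; rewrite szv /= => e.
by rewrite -ltn_predRL e; nia.
Qed.

(** * Common zeros by resultants *)

Section CommonZero.
Variable K : closedFieldType.

Definition eval2 (x y : K) : {rmorphism {poly {poly K}} -> K} :=
  horner_eval y \o map_poly (horner_eval x).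

Lemma eval2E x y r : eval2 x y r = (map_poly (horner_eval x) r).[y].
Proof. by rewrite /= horner_evalE. Qed.

(** If [r] is constant in y, the point (0, 1) serves. Otherwise some nonzero x keeps the leading
    coefficient nonzero, and the specialized polynomial has a root y. *)
Lemma eval2_zero (r : {poly {poly K}}) : eval2 0 0 r = 0 ->
  exists x y, ((x != 0) || (y != 0)) /\ eval2 x y r = 0.
Proof.
move=> r00; have [r_le1|r_gt1] := leqP (size r) 1.
  exists 0, 1; rewrite oner_neq0 orbT; split=> //; move: r00.
  by rewrite (size1_polyC r_le1) !eval2E map_polyC !hornerC.
have /closed_nonrootP[x] : 'X * lead_coef r != 0.
  by rewrite mulf_neq0 ?polyX_eq0 ?lead_coef_eq0 // -size_poly_gt0 ltnW.
rewrite rootM rootX negb_or => /andP[nz_x nz_lc].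
have /closed_rootP[y ry] : size (map_poly (horner_eval x) r) != 1%N.
  by rewrite size_map_poly_id0 ?gtn_eqF.
by exists x, y; rewrite nz_x eval2E; split=> //; apply/rootP.
Qed.

(** Unit leading coefficients make the resultant in z commute with specialization. It vanishes at x
    = y = 0, hence at another (x, y), over which [g] and [h] meet. *)
Lemma common_zero (g h : {poly {poly {poly K}}}) :
  lead_coef g \is a GRing.unit -> lead_coef h \is a GRing.unit ->
  (map_poly (eval2 0 0) g).[0] = 0 -> (map_poly (eval2 0 0) h).[0] = 0 ->
  exists x y z, [/\ (x != 0) || (y != 0),
    (map_poly (eval2 x y) g).[z] = 0 & (map_poly (eval2 x y) h).[z] = 0].
Proof.
move=> ug uh g0 h0.
have nz u x y : u \is a GRing.unit -> eval2 x y u != 0.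
  by move=> uu; rewrite -unitfE rmorph_unit.
have nz_map x y (u : {poly {poly {poly K}}}) :
    lead_coef u \is a GRing.unit -> map_poly (eval2 x y) u != 0.
  by move=> uu; rewrite -lead_coef_eq0 lead_coef_map_eq ?nz.
have res x y : eval2 x y (resultant g h) =
    resultant (map_poly (eval2 x y) g) (map_poly (eval2 x y) h).
  by rewrite map_resultant ?nz.
have gcd_neq0 x y : gcdp (map_poly (eval2 x y) g) (map_poly (eval2 x y) h) != 0.
  by rewrite gcdp_eq0 (negPf (nz_map x y g ug)).
have [|x [y [nz_xy]]] := @eval2_zero (resultant g h).
  apply/eqP; rewrite res resultant_eq0 ltn_neqAle size_poly_gt0 gcd_neq0 andbT eq_sym.
  by apply/closed_rootP; exists 0; rewrite root_gcd !rootE g0 h0 eqxx.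
rewrite res => /eqP; rewrite resultant_eq0 => sz.
have /closed_rootP[z] : size (gcdp (map_poly (eval2 x y) g) (map_poly (eval2 x y) h)) != 1%N.
  by rewrite gtn_eqF.
by rewrite root_gcd => /andP[/rootP gz /rootP hz]; exists x, y, z.
Qed.

End CommonZero.

(** * Factors of a homogeneous polynomial that do not vanish at the origin *)

Section ConstantFactor.
Variables (K : fieldType) (n N : nat) (F G H : {mpoly K[n]}).
Hypothesis GH : G * H = F.

Let scaled P : {poly {mpoly K[n]}} :=
  mmap (polyC \o @mpolyC n K) (fun i => 'X * ('X_i)%:P) P.

Lemma mmap_mpolyC_id (P : {mpoly K[n]}) : mmap (@mpolyC n K) (fun i => 'X_i) P = P.
Proof.
rewrite [RHS]mpolyE; apply: eq_bigr => m _.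
by rewrite mmap1_id mul_mpolyC.
Qed.

(* The second hypothesis says that [F] is homogeneous of degree [N]. *)
Lemma homog_factor_unit : F != 0 -> scaled F = 'X^N * F%:P ->
  mmap idfun (fun=> 0) G != 0 -> G \is a GRing.unit.
Proof.
move=> nz_F homF nz_G0.
have scaled0 : (scaled G).[0] = (mmap idfun (fun=> 0) G)%:MP.
  rewrite -horner_evalE; transitivity (mmap (@mpolyC n K) (fun=> 0) G).
    apply: rmorph_mmap => [t|i] /=; first by rewrite horner_evalE hornerC.
    by rewrite horner_evalE !hornerE.
  by apply/esym/rmorph_mmap => // i /=; rewrite mpolyC0.
have scaled1 : (scaled G).[1] = G.
  rewrite -horner_evalE -[RHS]mmap_mpolyC_id.
  apply: rmorph_mmap => [t|i] /=; first by rewrite horner_evalE hornerC.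
  by rewrite horner_evalE !hornerE.
have : scaled G * scaled H = 'X^N * F%:P by rewrite -homF -GH /scaled rmorphM.
case/mul_Xn_factor=> k [l [a [b [_ Ga _ Fab]]]].
have k0 : k = 0%N.
  apply/eqP; rewrite eqn0Ngt; apply: contra nz_G0 => k_gt0.
  by rewrite -(mpolyC_eq0 n) -scaled0 Ga hornerM hornerXn expr0n gtn_eqF // mul0r.
(* [F] is free of the new variable, hence so are [a] and [b]; the scaled [G] then takes the same
   value at 1, namely [G], and at 0, a constant. *)
have : size (a * b) == 1%N by rewrite -Fab size_polyC nz_F.
rewrite size_mul_eq1 => /andP[/eqP sza _].
rewrite k0 expr0 mul1r in Ga.
have Gc : scaled G = ((scaled G)`_0)%:P by rewrite Ga -size1_polyC ?sza.
rewrite -scaled1 Gc hornerC -horner_coef0 scaled0.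
by rewrite rmorph_unit // unitfE.
Qed.

End ConstantFactor.

(** * The DGZ polynomial as a Dickson form *)

Section DgzDickson.
Variables (p h q : nat) (Fq : finFieldType).
Hypothesis p_pr : prime p.
Hypothesis q_pX : q = (p ^ h)%N.
Hypothesis cardF : #|Fq| = q.

Lemma pchar_card : p \in [pchar Fq].
Proof.
have [p' p'_pr pcharF] := finPcharP Fq.
have := pprimeChar_pgroup pcharF; rewrite /pgroup cardsT cardF q_pX => p'_nat.
have h_gt0 : (0 < h)%N.
  by rewrite lt0n; apply: contraTneq (finNzRing_gt1 Fq) => h0; rewrite cardF q_pX h0.
by move: p'_nat; rewrite pnatX eqn0Ngt h_gt0 orbF pnatE // inE => /eqP->.
Qed.

Let X (m : nat) : {mpoly Fq[3]} := 'X_(inord m).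

Lemma dgz_dickson :
  [/\ dgz_poly Fq = dickson q (X 0) (X 1) (X 2),
      dgz_poly Fq = dickson q (X 1) (X 2) (X 0)
    & dgz_poly Fq = dickson q (X 2) (X 0) (X 1)].
Proof.
have frobP := frob_pchar pchar_card q_pX (@mpolyC 3 Fq).
have q_gt0 : (0 < q)%N by rewrite q_pX expn_gt0 prime_gt0.
have mooreE a b c : moore_det Fq [:: a; b; c] = det3
    (X 0 ^+ (q ^ a)) (X 0 ^+ (q ^ b)) (X 0 ^+ (q ^ c))
    (X 1 ^+ (q ^ a)) (X 1 ^+ (q ^ b)) (X 1 ^+ (q ^ c))
    (X 2 ^+ (q ^ a)) (X 2 ^+ (q ^ b)) (X 2 ^+ (q ^ c)).
  by rewrite -cardF; exact: Defs.mooreE.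
have powE (t : {mpoly Fq[3]}) : [/\ t ^+ (q ^ 0) = t, t ^+ (q ^ 1) = t ^+ q,
    t ^+ (q ^ 2) = t ^+ q ^+ q & t ^+ (q ^ 3) = t ^+ q ^+ q ^+ q].
  by rewrite !expnS expn0 !muln1 !exprM expr1.
have := proj1 (dgz_polyE _) (erefl (dgz_poly Fq)); have := dgz_D2_neq0 Fq.
rewrite /dgz_D1 /dgz_D2 !mooreE.
have [-> -> -> ->] := powE (X 0); have [-> -> -> ->] := powE (X 1).
have [-> -> -> ->] := powE (X 2).
exact: dickson_unique.
Qed.

End DgzDickson.

(** * Irreducibility over the algebraic closure *)

Theorem proposition4p7 (p h q : nat) (hp : prime p) (hq : q = (p ^ h)%N)
    (hq3 : (3 <= q)%N) (Fq : finFieldType) (hFq : #|Fq| = q)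
    (K : closedFieldType) (iota : {rmorphism Fq -> K})
    (hK : is_algebraic_closure iota) :
  irreducible_elt (map_mpoly iota (dgz_poly Fq)).
Proof.
have pcharK := rmorph_pchar iota (pchar_card hp hq hFq).
have q_gt1 : (1 < q)%N by exact: leq_trans hq3.
have q_gt0 := ltnW q_gt1.
have q0 := natr_q pcharK hq hq3.
set F := map_mpoly iota (dgz_poly Fq).
pose o m : 'I_3 := inord m.
have mapF i j k : dgz_poly Fq = dickson q 'X_(o i) 'X_(o j) 'X_(o k) ->
    F = dickson q 'X_(o i) 'X_(o j) 'X_(o k).
  by rewrite /F => ->; rewrite rmorph_dickson /= !map_mpolyX.
have [/mapF F012 /mapF F120 /mapF F201] := dgz_dickson hp hq hFq.
have oE i j : (i < 3)%N -> (j < 3)%N -> (o i == o j) = (i == j).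
  by move=> i3 j3; rewrite -val_eqE /= !inordK.
have evF (A : comNzRingType) (f : {rmorphism K -> A}) (x y z : A) :
    mmap f (coords (o 0%N) (o 1%N) x y z) F = dickson q x y z.
  rewrite F012 rmorph_dickson /= !mmapX !mmap1U /coords.
  by rewrite !oE.
have nz_F : F != 0.
  have : mmap idfun (coords (o 0%N) (o 1%N) 1 0 0) F != 0.
    have b0 : bracket q 1 0 = 0 :> K by rewrite /bracket expr0n gtn_eqF // !mulr0 subr0.
    by rewrite (evF _ idfun) dickson_rational ?oner_neq0.
  by apply: contraNneq => ->; rewrite rmorph0.
have F00 : mmap idfun (fun=> 0) F = 0.
  rewrite -(@rmorph_mmap _ _ _ _ idfun idfun _ (coords (o 0%N) (o 1%N) 0 0 0)) //.
    rewrite (evF _ idfun) -[X in dickson q X](mul0r 0) -[X in dickson q _ X](mul0r 0).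
    rewrite -[X in dickson q _ _ X](mul0r 0) dicksonZ // expr0n gtn_eqF ?mul0r //.
    by rewrite !muln_gt0 q_gt0 -ltnS prednK.
  by move=> i; rewrite /= /coords !if_same.
split=> // [|G H GH].
  apply/negP => unit_F.
  have : mmap idfun (fun=> 0) F \is a GRing.unit by rewrite rmorph_unit.
  by rewrite F00 unitr0.
have homF : mmap (polyC \o @mpolyC 3 K) (fun i => 'X * ('X_i)%:P) F
    = 'X^(q * q * q.-1) * F%:P.
  rewrite [in LHS]F012 rmorph_dickson /= !mmapX !mmap1U dicksonZ //.
  by rewrite -(rmorph_dickson (@polyC _)) -F012.
have [G0|nz_G0] := eqVneq (mmap idfun (fun=> 0) G) 0; last first.
  by left; apply: (homog_factor_unit (esym GH) nz_F homF).
have [H0|nz_H0] := eqVneq (mmap idfun (fun=> 0) H) 0; last first.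
  by right; apply: (homog_factor_unit (H := G) _ nz_F homF nz_H0); rewrite mulrC -GH.
exfalso.
(* [G] and [H] are read as polynomials in z over K[x][y]. *)
pose f : {rmorphism K -> {poly {poly {poly K}}}} := polyC \o (polyC \o @polyC K).
pose w := coords (o 0%N) (o 1%N) ('X%:P%:P : {poly {poly {poly K}}}) 'X%:P 'X.
have ev x y z P : (map_poly (eval2 x y) (mmap f w P)).[z]
    = mmap idfun (coords (o 0%N) (o 1%N) x y z) P.
  rewrite -horner_evalE -[LHS]/((horner_eval z \o map_poly (eval2 x y)) _).
  apply: rmorph_mmap => [t|i].
    by rewrite /= map_polyC /= map_polyC /= !horner_evalE !hornerC.
  rewrite -[LHS]/((map_poly (eval2 x y) (w i)).[z]) /w /coords.
  case: ifP => _.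
    by rewrite map_polyC hornerC -[LHS]/(eval2 x y 'X%:P) eval2E map_polyC hornerC /=
      horner_evalE hornerX.
  case: ifP => _; last by rewrite map_polyX hornerX.
  by rewrite map_polyC hornerC -[LHS]/(eval2 x y 'X) eval2E map_polyX hornerX.
have units : lead_coef (mmap f w G) * lead_coef (mmap f w H) = 1.
  have wF : mmap f w F = dickson q 'X%:P%:P 'X%:P 'X by exact: (evF _ f).
  have wGH : mmap f w F = mmap f w G * mmap f w H by rewrite GH rmorphM.
  by rewrite -lead_coefM -wGH wF lead_coef_dickson.
have [||||x [y [z [nz_xy]]]] := @common_zero K (mmap f w G) (mmap f w H).
- by apply/unitrPr; exists (lead_coef (mmap f w H)).
- by apply/unitrPr; exists (lead_coef (mmap f w G)); rewrite mulrC.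
- by rewrite ev -[RHS]G0; apply: (@rmorph_mmap _ _ _ _ idfun) => // i; rewrite /= /coords !if_same.
- by rewrite ev -[RHS]H0; apply: (@rmorph_mmap _ _ _ _ idfun) => // i; rewrite /= /coords !if_same.
rewrite !ev => Gxyz Hxyz.
have cyc i j (x' y' z' : K) P : coords i j x' y' z' =1 coords (o 0%N) (o 1%N) x y z ->
    mmap idfun (coords (o 0%N) (o 1%N) x y z) P = 0 -> mmap idfun (coords i j x' y' z') P = 0.
  by move=> eqc <-; apply: (@rmorph_mmap _ _ _ _ idfun).
have ocase (i : 'I_3) : [\/ i = o 0, i = o 1 | i = o 2].
  case: i => -[|[|[|//]]] i3; [constructor 1|constructor 2|constructor 3];
  by apply/val_inj; rewrite /= inordK.
(* The local study, applied in each cyclic order, makes all three brackets vanish at the common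
   zero. *)
have local i j k (x' y' z' : K) : uniq [:: o i; o j; o k] ->
    F = dickson q 'X_(o i) 'X_(o j) 'X_(o k) ->
    coords (o i) (o j) x' y' z' =1 coords (o 0%N) (o 1%N) x y z -> bracket q x' y' = 0.
  move=> ijk FE eqc; apply/eqP/negPn/negP => nz_d.
  apply: (@no_common_zero K p h q pcharK hq hq3 (o i) (o j) (o k) G H ijk _ x' y' z' nz_d).
  - by rewrite -GH.
  - exact: cyc Gxyz.
  exact: cyc Hxyz.
have uniq_o i j k : uniq [:: i; j; k] -> all (fun m => m < 3)%N [:: i; j; k] ->
    uniq [:: o i; o j; o k].
  by move=> + /and4P[i3 j3 k3 _]; rewrite /= !inE !oE.
have xy0 : bracket q x y = 0 by exact: (local 0%N 1%N 2%N x y z (uniq_o 0%N 1%N 2%N isT isT) F012).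
have yz0 : bracket q y z = 0.
  apply: (local 1%N 2%N 0%N y z x (uniq_o 1%N 2%N 0%N isT isT) F120) => m.
  by rewrite /coords; case: (ocase m) => ->; rewrite !oE.
have zx0 : bracket q z x = 0.
  apply: (local 2%N 0%N 1%N z x y (uniq_o 2%N 0%N 1%N isT isT) F201) => m.
  by rewrite /coords; case: (ocase m) => ->; rewrite !oE.
have bracketC u t : bracket q u t = - bracket q t u :> K by rewrite /bracket; ring.
have F0 : dickson q x y z = 0.
  by rewrite -(evF _ idfun) GH rmorphM /= Gxyz mul0r.
have xz0 : bracket q x z = 0 by rewrite bracketC zx0 oppr0.
have yx0 : bracket q y x = 0 by rewrite bracketC xy0 oppr0.
(* The point is now rational over Fq with x or y nonzero, so [F] cannot vanish there. *)
have [x0|nz_x] := eqVneq x 0; last first.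
  by have := dickson_rational q_gt1 q0 nz_x xy0 xz0; rewrite F0 eqxx.
have nz_y : y != 0 by move: nz_xy; rewrite x0 eqxx.
have F0' : dickson q y z x = 0.
  rewrite -F0 -(evF _ idfun x y z) F120 rmorph_dickson /= !mmapX !mmap1U /coords.
  by rewrite !oE.
by have := dickson_rational q_gt1 q0 nz_y yz0 yx0; rewrite F0' eqxx.
Qed.
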